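(* Let $m > 1$ be an integer prime to $N$, and suppose that $m \equiv \pm 1 \pmod{N}$ or $\Gamma = \Gamma_0(N)$. Then $\Phi_m^{\alpha}(X, Y) = \Phi_m^{\alpha}(Y, X)$.
   Context: Let $N$ be a positive integer and $\Gamma$ one of $\Gamma(N)$, $\Gamma_1(N)$, $\Gamma_0(N)$. Enhanced elliptic curves over $\mathbb{C}$ of level $\Gamma$ are pairs $(E,\ast)$: for $\Gamma(N)$ a basis $(P,Q)$ of $E[N]$ with $e_N(P,Q)=e^{2\pi i/N}$; for $\Gamma_1(N)$ a point $P$ of order $N$; for $\Gamma_0(N)$ a cyclic subgroup $C$ of order $N$. An isogeny of degree $m$ between them is an isogeny $\varphi:E\to E'$ of degree $m$ with $\varphi(P)=[m]P'$, $\varphi(Q)=Q'$ (resp. $\varphi(P)=P'$, resp. $\varphi(C)=C'$). Let $S$ be the set of isomorphism classes of enhanced elliptic curves of level $\Gamma$. Let $\alpha: S \to \mathbb{C}$ be an invariant of level $\Gamma$: an injection together with $j_\alpha(X)\in\mathbb{Q}(X)$ such that $j(E) = j_\alpha(\alpha(E,\ast))$, and, writing $j_\alpha = J_1/J_0$ in reduced form with $J_0,J_1\in\mathbb{Z}[X]$: $\deg J_1 > \deg J_0$, $J_0(z)=0$ for all $z\in\mathbb{C}\setminus\operatorname{im}\alpha$, $J_0$ is primitive, and the leading coefficient of $J_1$ is divisible by no prime not dividing $N$. Assume $\alpha$ has a good model: representatives $(E_z^\alpha,\ast)$, $z\in\operatorname{im}\alpha$, with surjective functions $x_z: E_z^\alpha(\mathbb{C})\to\mathbb{C}\cup\{\infty\}$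 such that $x_z^{-1}(\infty)\subset E_z^\alpha[N]$ and $x_z(R_1)=x_z(R_2)$ iff $R_1=\pm R_2+R_\infty$ for some $R_\infty\in x_z^{-1}(\infty)$; together with scalar multiplication formulas $M_m(X;Y)\in\mathbb{Z}(X;Y)$ with $x_z([m]R)=M_m(z;x_z(R))$; division polynomials $\Psi_m(X;Y)\in\mathbb{Z}[X;Y]$ whose leading coefficient in $Y$ is an integer divisible by no prime not dividing $m$, such that for $R\notin x_z^{-1}(\infty)$, $\Psi_m(z;x_z(R))=0$ iff $x_z([m]R)=x_z(0)$; and, for $m$ prime to $N$, isogeny formulas $V_m\in\mathbb{Z}[1/m][X;Y_1,\dots,Y_{m-1}]$ with $z'=V_m(z;x_z(R),\dots,x_z([m-1]R))$ for any generator $R$ of the kernel of a cyclic isogeny of degree $m$ from $(E_z^\alpha,\ast)$ to $(E_{z'}^\alpha,\ast)$. $\Phi_m^\alpha(X,Y)$ denotes the modular polynomial of order $m$ for $\alpha$: the (existing, unique) polynomial in $\mathbb{Z}[X,Y]$, monic of degree $\psi(m)$ in $Y$ (with $\psi$ the Dedekind function), such that $\Phi_m^\alpha(\alpha(E,\ast),\alpha(E',\ast))=0$ iff there is a cyclic isogeny of degree $m$ between $(E,\ast)$ and $(E',\ast)$. *)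

(* Defs.v *)
From HB Require Import structures.
From mathcomp Require Import all_boot all_order all_algebra.
From mathcomp Require Import fraction ring_quotient generic_quotient polyXY.
From mathcomp Require Import complex.
From mathcomp Require Import all_classical all_reals all_analysis.
(* Not imported: the notations of mpoly clash with those of mathcomp-analysis. *)
From mathcomp Require mpoly.

Set Implicit Arguments.
Unset Strict Implicit.
Unset Printing Implicit Defensive.

Import Order.TTheory GRing.Theory Num.Theory.
Import numFieldNormedType.Exports.

Local Open Scope classical_set_scope.
Local Open Scope ring_scope.
Local Open Scope complex_scope.
Local Open Scope quotient_scope.

(* Elliptic curves over C are complex tori C / (Z w1 + Z w2). The lattice is
   presented by a basis with w1 / w2 in the upper half plane; the torus depends
   only on the subgroup it spans, and isomorphisms ignore the chosen basis. *)
Record lattice (R : realType) := Lattice {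
  w1 : R[i];
  w2 : R[i];
  lattice_oriented : 0 < complex.Im (w1 / w2) }.

Definition in_lattice (R : realType) (L : lattice R) : {pred R[i]} :=
  fun z : R[i] => `[< exists a b : int, z = a%:~R * w1 L + b%:~R * w2 L >].

Lemma in_lattice_zmod_closed (R : realType) (L : lattice R) :
  zmod_closed (in_lattice L).
Proof.
split; first by apply/asboolP; exists 0, 0; rewrite !mul0r addr0.
move=> x y /asboolP[a [b ->]] /asboolP[c [d ->]]; apply/asboolP.
by exists (a - c), (b - d); rewrite !intrB !mulrBl addrACA opprD.
Qed.

HB.instance Definition _ (R : realType) (L : lattice R) :=
  GRing.isZmodClosed.Build R[i] (in_lattice L) (in_lattice_zmod_closed L).

Definition torus (R : realType) (L : lattice R) : zmodType :=
  {ideal_quot in_lattice L}.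

Definition torus_pi (R : realType) (L : lattice R) (z : R[i]) : torus L :=
  \pi_{ideal_quot in_lattice L} z.

Definition expi (R : realType) (t : R) : R[i] := cos t +i* sin t.

(* The sum of w ^- k over the nonzero lattice points w, taken along the squares
   [-n, n]^2; for k >= 3 the series converges absolutely. *)
Definition eisenstein (R : realType) (L : lattice R) (k : nat) : R[i] :=
  lim ((fun n : nat =>
    \sum_(i < n.*2.+1) \sum_(j < n.*2.+1)
      (if (i == n :> nat) && (j == n :> nat) then 0
       else ((i%:R - n%:R) * w1 L + (j%:R - n%:R) * w2 L) ^- k)
    : R[i]^o) @ \oo).

Definition g2 (R : realType) (L : lattice R) : R[i] := 60%:R * eisenstein L 4.
Definition g3 (R : realType) (L : lattice R) : R[i] := 140%:R * eisenstein L 6.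

Definition j_invariant (R : realType) (L : lattice R) : R[i] :=
  1728%:R * g2 L ^+ 3 / (g2 L ^+ 3 - 27%:R * g3 L ^+ 2).

Definition has_order (V : zmodType) (P : V) (n : nat) : Prop :=
  P *+ n = 0 /\ forall k : nat, (0 < k < n)%N -> P *+ k <> 0.

(* For P of finite order the natural multiples of P form the subgroup <P>. *)
Definition multiples (V : zmodType) (P : V) : set V := range (GRing.natmul P).

Definition cyclic_subgroup (V : zmodType) (n : nat) (A : set V) : Prop :=
  exists P : V, has_order P n /\ A = multiples P.

Definition torsion_basis (V : zmodType) (N : nat) (P Q : V) : Prop :=
  [/\ P *+ N = 0, Q *+ N = 0 &
      forall T : V, T *+ N = 0 ->
        exists! ab : 'I_N * 'I_N, T = P *+ ab.1 + Q *+ ab.2].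

(* The graph of the Weil pairing: e_N(P, Q) = exp (2 pi i (ad - bc) / N) when
   P = (a w1 + b w2) / N and Q = (c w1 + d w2) / N modulo the lattice. It is
   a function on E[N] x E[N], independent of the oriented basis. *)
Definition weil_pairing (R : realType) (L : lattice R) (N : nat)
    (P Q : torus L) (e : R[i]) : Prop :=
  exists a b c d : int,
    [/\ P = torus_pi L ((a%:~R * w1 L + b%:~R * w2 L) / N%:R),
        Q = torus_pi L ((c%:~R * w1 L + d%:~R * w2 L) / N%:R) &
        e = expi (2%:R * pi * (a * d - b * c)%:~R / N%:R)].

Definition additive_map (V W : zmodType) (phi : V -> W) : Prop :=
  forall P Q : V, phi (P + Q) = phi P + phi Q.

Definition holomorphic_map (R : realType) (L L' : lattice R)
    (phi : torus L -> torus L') : Prop :=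
  forall z0 : R[i]^o, exists f : R[i]^o -> R[i]^o,
    \forall z \near z0,
      derivable f z 1 /\ torus_pi L' (f z) = phi (torus_pi L z).

Definition kerset (V W : zmodType) (phi : V -> W) : set V :=
  [set P | phi P = 0].

Definition isogeny (R : realType) (L L' : lattice R)
    (phi : torus L -> torus L') : Prop :=
  [/\ additive_map phi, holomorphic_map phi & exists P, phi P <> 0].

(* An isogeny over C is unramified, so its degree is the order of its kernel. *)
Definition isogeny_of_degree (R : realType) (m : nat) (L L' : lattice R)
    (phi : torus L -> torus L') : Prop :=
  isogeny phi /\ (kerset phi #= `I_m)%card.

Variant level_kind := GammaFull | Gamma1 | Gamma0.

Definition level_data (G : level_kind) (V : zmodType) : Type :=
  match G with
  | GammaFull => (V * V)%type
  | Gamma1 => V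
  | Gamma0 => set V
  end.

Definition is_level_structure (R : realType) (N : nat) (G : level_kind)
    (L : lattice R) : level_data G (torus L) -> Prop :=
  match G with
  | GammaFull => fun PQ => torsion_basis N PQ.1 PQ.2 /\
      weil_pairing N PQ.1 PQ.2 (expi (2%:R * pi / N%:R))
  | Gamma1 => fun P => has_order P N
  | Gamma0 => fun A => cyclic_subgroup N A
  end.

Record enhanced (R : realType) (N : nat) (G : level_kind) := Enhanced {
  curve : lattice R;
  level : level_data G (torus curve);
  levelP : is_level_structure N level }.

Definition preserves_level (m : nat) (G : level_kind) (V W : zmodType)
    (phi : V -> W) : level_data G V -> level_data G W -> Prop :=
  match G with
  | GammaFull => fun PQ PQ' => phi PQ.1 = PQ'.1 *+ m /\ phi PQ.2 = PQ'.2
  | Gamma1 => fun P P' => phi P = P'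
  | Gamma0 => fun A A' => phi @` A = A'
  end.

Definition enhanced_isogeny (R : realType) (N : nat) (G : level_kind) (m : nat)
    (e e' : enhanced R N G) (phi : torus (curve e) -> torus (curve e')) : Prop :=
  isogeny_of_degree m phi /\ preserves_level m phi (level e) (level e').

Definition enhanced_iso (R : realType) (N : nat) (G : level_kind)
    (e e' : enhanced R N G) : Prop :=
  exists (phi : torus (curve e) -> torus (curve e'))
         (psi : torus (curve e') -> torus (curve e)),
    [/\ isogeny phi, isogeny psi, cancel phi psi, cancel psi phi &
        preserves_level 1 phi (level e) (level e')].

Definition cyclic_isogeny (R : realType) (N : nat) (G : level_kind) (m : nat)
    (e e' : enhanced R N G) : Prop :=
  exists phi : torus (curve e) -> torus (curve e'),
    enhanced_isogeny m phi /\ exists P, kerset phi = multiples P.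

(* Bivariate polynomials in X, Y are {poly {poly _}} with Y outermost; this
   substitutes z for X. *)
Definition specialize (R : realType) (z : R[i]) (p : {poly {poly int}}) :
    {poly R[i]} :=
  map_poly (horner_eval z \o map_poly intr) p.

(* The rational function a / b (b <> 0) as a map of P^1(K) = option K to itself,
   None being the point at infinity. *)
Definition ratfun_eval (K : fieldType) (a b : {poly K}) (y : option K) :
    option K :=
  let a' := a %/ gcdp a b in
  let b' := b %/ gcdp a b in
  match y with
  | Some t => if b'.[t] == 0 then None else Some (a'.[t] / b'.[t])
  | None => if (size b' < size a')%N then None
            else Some (a'`_(size b').-1 / lead_coef b')
  end.

(* v = M(z; y): the value does not depend on the choice of a and b, and suitable
   a and b exist unless z is a pole of M as a rational function over Q(Y). *)
Definition ratfun2_value (R : realType) (M : {fraction {poly {poly int}}})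
    (z : R[i]) (y v : option R[i]) : Prop :=
  exists a b : {poly {poly int}},
    [/\ b != 0, M = tofrac a / tofrac b, specialize z b != 0 &
        v = ratfun_eval (specialize z a) (specialize z b) y].

Definition no_prime_factor_outside (n : nat) (c : int) : Prop :=
  forall p : nat, prime p -> ~~ (p %| n)%N -> ~~ (p%:Z %| c)%Z.

(* alpha is given on enhanced curves; the first field says that it induces an
   injection on their isomorphism classes. The rational function j_alpha is
   inv_J1 / inv_J0. *)
Record modular_invariant (R : realType) (N : nat) (G : level_kind)
    (alpha : enhanced R N G -> R[i]) := ModularInvariant {
  inv_inj : forall e e', alpha e = alpha e' <-> enhanced_iso e e';
  inv_J0 : {poly int};
  inv_J1 : {poly int};
  inv_reduced :
    coprimep (map_poly intr inv_J1 : {poly rat}) (map_poly intr inv_J0);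
  inv_jE : forall e,
    (map_poly intr inv_J0).[alpha e] != 0 /\
    j_invariant (curve e) =
      (map_poly intr inv_J1).[alpha e] / (map_poly intr inv_J0).[alpha e];
  inv_deg : (size inv_J0 < size inv_J1)%N;
  inv_poles : forall z : R[i], ~ range alpha z ->
    (map_poly intr inv_J0).[z] = 0;
  inv_primitive : `|zcontents inv_J0| = 1;
  inv_lead : no_prime_factor_outside N (lead_coef inv_J1) }.

(* In the isogeny formulas, variable 0 is X and variable i > 0 is Y_i. *)
Record good_model (R : realType) (N : nat) (G : level_kind)
    (alpha : enhanced R N G -> R[i]) := GoodModel {
  model : R[i] -> enhanced R N G;
  modelP : forall z, range alpha z -> alpha (model z) = z;
  xcoord : forall z, torus (curve (model z)) -> option R[i];
  xcoord_surj : forall z, range alpha z ->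
    forall v, exists P, @xcoord z P = v;
  xcoord_infty : forall z, range alpha z ->
    forall P, @xcoord z P = None -> P *+ N = 0;
  xcoord_eq : forall z, range alpha z -> forall P Q,
    @xcoord z P = @xcoord z Q <->
    exists T, @xcoord z T = None /\ (P = Q + T \/ P = - Q + T);
  scalar_formula : nat -> {fraction {poly {poly int}}};
  scalar_formulaP : forall m, (0 < m)%N -> forall z, range alpha z ->
    forall P, ratfun2_value (scalar_formula m) z (@xcoord z P)
                (@xcoord z (P *+ m));
  division_poly : nat -> {poly {poly int}};
  division_poly_lead : forall m, (0 < m)%N ->
    exists2 c : int, lead_coef (division_poly m) = c%:P &
                     no_prime_factor_outside m c;
  division_polyP : forall m, (0 < m)%N -> forall z, range alpha z ->
    forall P t, @xcoord z P = Some t ->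
      (specialize z (division_poly m)).[t] = 0 <->
      @xcoord z (P *+ m) = @xcoord z 0;
  isogeny_formula : forall m : nat, mpoly.mpoly m rat;
  isogeny_formula_coef : forall m, (0 < m)%N -> coprime m N ->
    forall mon, exists (k : nat) (c : int),
      mpoly.mcoeff mon (isogeny_formula m) * m%:R ^+ k = c%:~R;
  isogeny_formulaP : forall m, (0 < m)%N -> coprime m N ->
    forall z z', range alpha z -> range alpha z' ->
    forall phi : torus (curve (model z)) -> torus (curve (model z')),
      enhanced_isogeny m phi ->
    forall P, kerset phi = multiples P ->
    exists2 y : 'I_m -> R[i],
      forall i : 'I_m, (0 < i)%N -> @xcoord z (P *+ i) = Some (y i) &
      z' = mpoly.meval (fun i : 'I_m => if i == 0%N :> nat then z else y i)
             (mpoly.map_mpoly ratr (isogeny_formula m)) }.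

(* psi(m) = m * prod_(p | m) (1 + 1/p) *)
Definition dedekind_psi (m : nat) : nat :=
  (\prod_(p <- primes m) (p ^ (logn p m).-1 * p.+1))%N.

Definition is_modular_polynomial (R : realType) (N : nat) (G : level_kind)
    (alpha : enhanced R N G -> R[i]) (m : nat) (Phi : {poly {poly int}}) :
    Prop :=
  [/\ Phi \is monic, size Phi = (dedekind_psi m).+1 &
      forall e e' : enhanced R N G,
        (specialize (alpha e) Phi).[alpha e'] = 0 <-> cyclic_isogeny m e e'].

(* Main.v *)
(* Take e = (C/L, level) without complex multiplication. The psi(m) lattices
   L' = L + Z x/m, with x primitive in L and taken modulo m up to units, carry
   level structures e' such that the identity induces a cyclic isogeny e -> e' and
   multiplication by m or -m induces one back, thanks to the hypothesis on m. These
   e' are pairwise non-isomorphic and not isomorphic to e: an isomorphism is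
   multiplication by some k, m k is an endomorphism of L, hence an integer, and
   comparing areas determines k up to sign. So for z = alpha(e) the values alpha(e')
   are psi(m) distinct common roots of Phi(z, Y) and Phi(Y, z), and all the roots of
   the former. Letting e run through infinitely many classes, the remainder of
   Phi(Y, X) by Phi(X, Y) vanishes, so Phi(Y, X) = Q Phi(X, Y), and Q = 1 or -1 by
   swapping again. Finally Q = -1 would give Phi(X, X) = 0, making z itself one more
   root of Phi(z, Y). *)
Require Import Defs.
From mathcomp Require Import all_boot all_order all_algebra.
From mathcomp Require Import polyXY complex.
From mathcomp Require Import ring_quotient zify ring lra.
From mathcomp Require Import all_classical all_reals all_analysis.

Import Order.TTheory GRing.Theory Num.Theory numFieldNormedType.Exports.

Local Open Scope ring_scope.

(** * Points of the projective line over Z/m *)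

(* (u i : v i) are n points of the projective line over Z/m; they are pairwise
   distinct because the 2 x 2 determinants do not vanish. *)
Definition projective_family (m n : nat) : Prop :=
  exists (I : finType) (u v : I -> nat),
    [/\ #|I| = n, forall i, coprime (gcdn (u i) (v i)) m &
        forall i j, (u i * v j)%N = (u j * v i)%N %[mod m] -> i = j].

Lemma projective_family1 : projective_family 1 1.
Proof.
exists unit, (fun=> 1%N), (fun=> 0%N); split; first exact: card_unit.
  by move=> _; rewrite coprimen1.
by move=> [] [].
Qed.

(* The two charts (1 : y) and (p x : 1). *)
Lemma projective_family_primepow (p k : nat) (hp : prime p) :
  projective_family (p ^ k.+1) (p ^ k * p.+1).
Proof.
have p1 := prime_gt1 hp; have p0 := prime_gt0 hp.
have absurd1 x y : 1 = (p * x * y)%N %[mod p ^ k.+1] -> False.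
  move=> /(congr1 (fun t => t %% p)%N).
  by rewrite !modn_dvdm ?dvdn_exp // -mulnA modnMr modn_small.
exists ('I_(p ^ k.+1) + 'I_(p ^ k))%type,
  (fun i => match i with inl _ => 1%N | inr x => (p * nat_of_ord x)%N end),
  (fun i => match i with inl y => nat_of_ord y | inr _ => 1%N end); split.
- by rewrite card_sum !card_ord expnS mulnC mulnS addnC mulnC.
- by case=> x; rewrite ?gcd1n ?gcdn1 coprime1n.
- case=> x [] y; rewrite ?mul1n ?muln1.
  + by rewrite !modn_small ?ltn_ord // => /val_inj ->.
  + by move=> /absurd1.
  + by move=> /esym /absurd1.
  + rewrite expnS -!muln_modr !modn_small // => /eqP.
    by rewrite eqn_pmul2l // => /eqP /val_inj ->.
Qed.

(** Chinese remaindering of the coordinates: both conditions depend only on residues modulo [m1] and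
    [m2]. *)
Lemma projective_family_mul (m1 m2 n1 n2 : nat) : coprime m1 m2 ->
  projective_family m1 n1 -> projective_family m2 n2 ->
  projective_family (m1 * m2) (n1 * n2).
Proof.
move=> co [I1 [u1 [v1 [c1 g1 d1]]]] [I2 [u2 [v2 [c2 g2 d2]]]].
have gcd_congr a b a' b' d : a = a' %[mod d] -> b = b' %[mod d] ->
    coprime (gcdn a b) d = coprime (gcdn a' b') d.
  move=> ha hb; rewrite /coprime -![gcdn (gcdn _ _) d]gcdnA.
  rewrite -[gcdn b d]gcdn_modl hb gcdn_modl.
  by rewrite gcdnCA -[gcdn a d]gcdn_modl ha gcdn_modl gcdnCA.
have det_congr a b a' b' c e c' e' d :
    a = a' %[mod d] -> b = b' %[mod d] -> c = c' %[mod d] -> e = e' %[mod d] ->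
    (a * b)%N = (c * e)%N %[mod d] -> (a' * b')%N = (c' * e')%N %[mod d].
  move=> ha hb hc he; rewrite -modnMml ha -modnMmr hb.
  by rewrite -[in RHS]modnMml hc -[in RHS]modnMmr he !(modnMml, modnMmr).
have cl := chinese_modl co; have cr := chinese_modr co.
exists (I1 * I2)%type,
  (fun i => chinese m1 m2 (u1 i.1) (u2 i.2)),
  (fun i => chinese m1 m2 (v1 i.1) (v2 i.2)); split.
- by rewrite card_prod c1 c2.
- move=> [i1 i2] /=; rewrite coprimeMr.
  by rewrite (gcd_congr _ _ _ _ _ (cl _ _) (cl _ _)) g1
             (gcd_congr _ _ _ _ _ (cr _ _) (cr _ _)) g2.
- move=> [i1 i2] [j1 j2] /= /eqP; rewrite chinese_remainder //.
  case/andP=> /eqP h1 /eqP h2; congr pair.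
  + apply: d1; exact: det_congr (cl _ _) (cl _ _) (cl _ _) (cl _ _) h1.
  + apply: d2; exact: det_congr (cr _ _) (cr _ _) (cr _ _) (cr _ _) h2.
Qed.

Lemma projective_family_psi (m : nat) (hm : (0 < m)%N) :
  projective_family m (dedekind_psi m).
Proof.
have {1}-> : m = (\prod_(p <- primes m) p ^ (logn p m).-1.+1)%N.
  rewrite {1}[m]prod_prime_decomp // prime_decompE big_map /=.
  apply: eq_big_seq => p; rewrite mem_primes => /and3P[hp _ hd].
  by rewrite prednK // logn_gt0 mem_primes hp hm.
rewrite /dedekind_psi.
have : all prime (primes m).
  by apply/allP => p; rewrite mem_primes => /and3P[].
elim: (primes m) (primes_uniq m) => [|p s IHs] /=.
  by rewrite !big_nil => _ _; exact: projective_family1.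
move=> /andP[ps us] /andP[hp hs]; rewrite !big_cons.
apply: projective_family_mul; last exact: IHs.
  rewrite coprimeXl // big_seq; apply: (big_ind (fun x => coprime p x)).
  - exact: coprimen1.
  - by move=> x y; rewrite coprimeMr => -> ->.
  - move=> q qs; rewrite coprimeXr // prime_coprime // dvdn_prime2 //.
      by apply: contraNneq ps => ->.
    exact: (allP hs).
exact: projective_family_primepow.
Qed.

(* gcd (u i) (v i) is prime to m, so dividing by it does not move the point. *)
Lemma unimodular_family (m : nat) (hm : (1 < m)%N) :
  exists (I : finType) (u v r s : I -> int),
    [/\ #|I| = dedekind_psi m, forall i, u i * s i - v i * r i = 1 &
        forall i j, (m%:Z %| u i * v j - u j * v i)%Z -> i = j].
Proof.
have [I [u [v [cI co inj]]]] := projective_family_psi m (ltnW hm).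
have g0 i : (0 < gcdn (u i) (v i))%N.
  rewrite lt0n; apply/eqP => g0; have := co i.
  by rewrite g0 /coprime gcd0n => /eqP e; rewrite e in hm.
pose g i := gcdn (u i) (v i).
have ug i : (u i %/ g i * g i)%N = u i by rewrite divnK // dvdn_gcdl.
have vg i : (v i %/ g i * g i)%N = v i by rewrite divnK // dvdn_gcdr.
have bez i : exists rs : int * int,
    (u i %/ g i)%N%:Z * rs.2 - (v i %/ g i)%N%:Z * rs.1 = 1.
  have [a [b e]] := Bezoutz (u i %/ g i)%N (v i %/ g i)%N.
  exists (- b, a) => /=.
  rewrite mulrN opprK mulrC [_ * b]mulrC e /gcdz !absz_nat.
  have : (gcdn (u i %/ g i) (v i %/ g i) * g i = g i)%N.
    by rewrite muln_gcdl ug vg.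
  by rewrite -[in RHS](mul1n (g i)) => /eqP; rewrite (eqn_pmul2r (g0 i)) => /eqP ->.
have [rs hrs] := choice bez.
exists I, (fun i => (u i %/ g i)%N%:Z), (fun i => (v i %/ g i)%N%:Z),
  (fun i => (rs i).1), (fun i => (rs i).2); split=> //.
move=> i j; rewrite -eqz_mod_dvd => /eqP h; apply: inj.
move: h; rewrite -!PoszM !modz_nat => -[h].
(* Multiplying the congruence of reduced coordinates by [g i * g j] restores the original ones. *)
rewrite -(ug i) -(vg j) -(ug j) -(vg i) mulnACA.
by rewrite [in RHS]mulnACA [(g j * g i)%N]mulnC -modnMml h modnMml.
Qed.

(** * Symmetry of a bivariate polynomial deduced from its zeros *)

Section Poly.
Context {R : realType}.
Implicit Types (p q : {poly {poly int}}) (z y : R[i]).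

Lemma horner_specialize z p y :
  (specialize z p).[y] = (map_poly (map_poly intr) p).[y, z].
Proof.
by rewrite /specialize -horner2_swapXY horner_swapXY -map_poly_comp.
Qed.

Lemma specializeD z : {morph specialize z : p q / p + q}.
Proof. by move=> p q; exact: raddfD. Qed.

Lemma specializeM z : {morph specialize z : p q / p * q}.
Proof. by move=> p q; exact: rmorphM. Qed.

Lemma size_specialize z p : (size (specialize z p) <= size p)%N.
Proof. exact: size_poly. Qed.

Lemma specialize_swapXY z p y :
  (specialize z (swapXY p)).[y] = (specialize y p).[z].
Proof. by rewrite !horner_specialize -swapXY_map horner2_swapXY. Qed.

Lemma poly_int_eq0 (z : nat -> R[i]) (a : {poly int}) : injective z ->
  (forall k, (map_poly intr a).[z k] = 0) -> a = 0.
Proof.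
move=> zinj a0; apply: (map_inj_poly (@intr_inj R[i])) => //; rewrite rmorph0.
apply: (@roots_geq_poly_eq0 _ _ (map z (iota 0 (size a)))).
- by apply/allP => _ /mapP[k _ ->]; rewrite /root a0.
- by rewrite map_inj_uniq ?iota_uniq.
- by rewrite size_map size_iota size_poly.
Qed.

(** Each coefficient in Y is an integer polynomial in X with infinitely many roots. *)
Lemma specialize_eq0 (z : nat -> R[i]) p : injective z ->
  (forall k, specialize (z k) p = 0) -> p = 0.
Proof.
move=> zinj p0; apply/polyP => i; rewrite coef0; apply: (poly_int_eq0 z) => // k.
by have /polyP/(_ i) := p0 k; rewrite coef_map_id0 ?coef0 //= ?rmorph0 ?horner_evalE ?horner0.
Qed.

(** Swapping twice gives p = swapXY q * q * p, so q is a unit of Z[X, Y], hence a unit of Z. *)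
Lemma swapXY_unit_sign {p q} : p != 0 -> swapXY p = q * p -> q = 1 \/ q = -1.
Proof.
move=> p0 e; have : swapXY q * q = 1.
  apply: (mulIf p0); rewrite mul1r -mulrA -e -(rmorphM swapXY) -e.
  exact: swapXYK.
move=> e1; have : q \is a GRing.unit.
  by apply/unitrP; exists (swapXY q); rewrite [q * _]mulrC.
rewrite poly_unitE => /andP[/size_poly1P[a a0 ->]].
rewrite coefC eqxx poly_unitE => /andP[/size_poly1P[c c0 ->]].
rewrite coefC eqxx => /orP[] /eqP ->; first by left.
by right; rewrite !polyCN.
Qed.

Lemma swapXY_of_zeros (Phi : {poly {poly int}}) (n : nat) (I : finType)
    (z : nat -> R[i]) (w : nat -> I -> R[i]) :
  Phi \is monic -> size Phi = n.+1 -> #|I| = n -> injective z ->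
  (forall k, injective (w k)) -> (forall k i, w k i != z k) ->
  (forall k i, (specialize (z k) Phi).[w k i] = 0) ->
  (forall k i, (specialize (w k i) Phi).[z k] = 0) ->
  swapXY Phi = Phi.
Proof.
move=> mon sz cI zinj winj wz h1 h2.
have uw k : uniq (map (w k) (enum I)) by rewrite map_inj_uniq ?enum_uniq.
have sw k : size (map (w k) (enum I)) = n by rewrite size_map -cardE.
(* The remainder has degree less than n in Y, yet specialized at [z k] it vanishes at the n distinct
   [w k i]. *)
have /specialize_eq0 rem0 : forall k,
    specialize (z k) (Pdiv.CommonRing.rmodp (swapXY Phi) Phi) = 0.
  move=> k; apply: (roots_geq_poly_eq0 _ (uw k)).
    apply/allP => _ /mapP[i _ ->]; rewrite /root.
    have /(congr1 (fun p => (specialize (z k) p).[w k i])) :=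
      Pdiv.RingMonic.rdivp_eq mon (swapXY Phi).
    rewrite specialize_swapXY specializeD specializeM hornerD hornerM h1 h2.
    by rewrite mulr0 add0r => <-.
  rewrite sw -ltnS -sz (leq_ltn_trans (size_specialize _ _)) //.
  by rewrite Pdiv.CommonRing.ltn_rmodpN0 ?monic_neq0.
have := Pdiv.RingMonic.rdivp_eq mon (swapXY Phi).
rewrite (rem0 zinj) addr0 => e.
case: (swapXY_unit_sign (monic_neq0 mon) e) => q1.
  by rewrite e q1 mul1r.
rewrite q1 mulN1r in e.
(* Antisymmetry makes twice this value vanish, and [z 0] becomes one root too many for a monic
   polynomial of degree n. *)
have z0 : (specialize (z 0) Phi).[z 0] = 0.
  have := specialize_swapXY (z 0) Phi (z 0).
  rewrite e {1}/specialize rmorphN hornerN => /eqP.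
  by rewrite eq_sym -addr_eq0 -mulr2n mulrn_eq0 /= => /eqP.
have mon0 : specialize (z 0) Phi \is monic by exact: monic_map.
have := @max_poly_roots _ (specialize (z 0) Phi) (z 0 :: map (w 0) (enum I)).
rewrite monic_neq0 // /= uw sw andbT /root z0 eqxx /=.
rewrite ltnNge (leq_trans (size_specialize _ _)) ?sz // => H.
have : false; last by []; apply: H => //.
  by apply/allP => _ /mapP[i _ ->]; rewrite /root h1.
by apply/mapP => -[i _ /eqP]; rewrite eq_sym (negPf (wz 0 i)).
Qed.

End Poly.

(** * Lattices *)

Section Lattices.
Local Open Scope complex_scope.
Context {R : realType}.
Implicit Types (L : lattice R) (x y z : R[i]).

(* cross x y = Im (x * conj y) is the area of the lattice spanned by x and y. *)
Definition cross x y : R := complex.Im x * complex.Re y - complex.Re x * complex.Im y.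

Definition normsq x : R := complex.Re x ^+ 2 + complex.Im x ^+ 2.

Lemma intcE (n : int) : n%:~R = (n%:~R)%:C :> R[i].
Proof. by rewrite rmorph_int. Qed.

Lemma cross_int (a b c d : int) x y :
  cross (a%:~R * x + b%:~R * y) (c%:~R * x + d%:~R * y) =
  (a * d - b * c)%:~R * cross x y.
Proof.
rewrite !intcE /cross; case: x y => [x1 x2] [y1 y2] /=.
by rewrite !rmorphB !rmorphM /=; ring.
Qed.

Lemma cross_scale k x y : cross (k * x) (k * y) = normsq k * cross x y.
Proof.
by rewrite /cross /normsq; case: k x y => [k1 k2] [x1 x2] [y1 y2] /=; ring.
Qed.

(** This turns the orientation condition on x / y into the sign of [cross], which is bilinear. *)
Lemma cross_div x y : cross x y = complex.Im (x / y) * normsq y.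
Proof.
have [->|y0] := eqVneq y 0.
  by rewrite /cross /normsq /= !mulr0 subrr expr0n addr0 mulr0.
rewrite -{1}(divfK y0 x); move: (x / y) => t.
rewrite /cross /normsq; case: t y {y0} => [t1 t2] [y1 y2] /=; ring.
Qed.

Lemma normsq_gt0 x : x != 0 -> 0 < normsq x.
Proof.
case: x => a b; rewrite eq_complex /= negb_and /normsq /=.
by case/orP => h; [apply: ltr_wpDr|apply: ltr_wpDl];
   rewrite ?sqr_ge0 // lt_neqAle sqr_ge0 eq_sym sqrf_eq0 h.
Qed.

Lemma w2_neq0 L : w2 L != 0.
Proof.
by apply/eqP => e; have := lattice_oriented L; rewrite e invr0 mulr0 /= ltxx.
Qed.

Lemma cross_lattice_gt0 L : 0 < cross (w1 L) (w2 L).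
Proof.
by rewrite cross_div mulr_gt0 ?lattice_oriented ?normsq_gt0 ?w2_neq0.
Qed.

Lemma oriented_of_cross x y : 0 < cross x y -> 0 < complex.Im (x / y).
Proof.
rewrite cross_div; have [->|y0] := eqVneq y 0.
  by rewrite invr0 mulr0 /= mul0r ltxx.
by rewrite pmulr_lgt0 // normsq_gt0.
Qed.

Lemma in_latticeP L z : reflect
  (exists a b : int, z = a%:~R * w1 L + b%:~R * w2 L) (z \in in_lattice L).
Proof. exact: asboolP. Qed.

(** Nonzero [cross] is linear independence over the reals; the orientation is left free. *)
Definition is_basis L x y : Prop := cross x y != 0 /\
  forall z, z \in in_lattice L <-> exists a b : int, z = a%:~R * x + b%:~R * y.

Lemma is_basis_w L : is_basis L (w1 L) (w2 L).
Proof.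
split; first by rewrite gt_eqF ?cross_lattice_gt0.
by move=> z; split=> /in_latticeP.
Qed.

Lemma is_basis_sl2 {L x y} {u v r s : int} : u * s - v * r = 1 ->
  is_basis L x y ->
  is_basis L (u%:~R * x + v%:~R * y) (r%:~R * x + s%:~R * y).
Proof.
move=> det [xy0 xyP]; split; first by rewrite cross_int det mul1r.
move=> z; rewrite xyP; split=> -[a [b ->]].
  exists (a * s - b * r), (b * u - a * v).
  rewrite -[in LHS](mulr1 a) -[in LHS](mulr1 b) -det.
  by rewrite !(rmorphB, rmorphM) /=; ring.
exists (a * u + b * r), (a * v + b * s).
by rewrite !(rmorphD, rmorphM) /=; ring.
Qed.

(** [cross] with y isolates the coefficient of x, and [cross] with x that of y up to sign. *)
Lemma cross_free {x y} {a b c d : int} : cross x y != 0 ->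
  a%:~R * x + b%:~R * y = c%:~R * x + d%:~R * y -> a = c /\ b = d.
Proof.
move=> xy0 e.
have := congr1 (fun t => cross t (0%:~R * x + 1%:~R * y)) e.
have := congr1 (fun t => cross t (1%:~R * x + 0%:~R * y)) e.
rewrite /= !cross_int !mulr1 !mulr0 !subr0 !sub0r.
by split; [move: H0|move: H] => /(mulIf xy0) /intr_inj // /oppr_inj.
Qed.

(** Written in the basis of larger area, the other one has a positive integer determinant, hence at
    least 1, so its area is not smaller. *)
Lemma is_basis_cross L x y x' y' : is_basis L x y -> is_basis L x' y' ->
  0 < cross x y -> 0 < cross x' y' -> cross x y = cross x' y'.
Proof.
wlog le : x y x' y' / cross x y <= cross x' y'.
  by move=> h; case: (leP (cross x y) (cross x' y')) => [|/ltW] l *;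
    [|apply/esym]; exact: h.
move=> [_ P] [_ P'] p p'; apply/eqP; rewrite eq_le le /=.
have inL z : (exists a b : int, z = a%:~R * x + b%:~R * y) ->
    exists a b : int, z = a%:~R * x' + b%:~R * y'.
  by rewrite -P -P'.
have [a [b ex]] : exists a b : int, x = a%:~R * x' + b%:~R * y'.
  by apply: inL; exists 1, 0; ring.
have [c [d ey]] : exists a b : int, y = a%:~R * x' + b%:~R * y'.
  by apply: inL; exists 0, 1; ring.
move: p; rewrite {}ex {}ey cross_int pmulr_lgt0 // ltr0z => det.
by apply: (ler_peMl (ltW p')); rewrite ler1z -gtz0_ge1.
Qed.

Lemma torus_pi_eq L x y :
  torus_pi L x = torus_pi L y <-> x - y \in in_lattice L.
Proof. by rewrite Quotient.idealrBE; split=> [h|/eqP]; first exact/eqP. Qed.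

Lemma torus_pi_surj {L} (P : torus L) : exists z, P = torus_pi L z.
Proof. by exists (repr P); rewrite /torus_pi reprK. Qed.

Lemma torus_piD L : {morph torus_pi L : x y / x + y}.
Proof. by move=> x y; rewrite /torus_pi; exact: raddfD. Qed.

End Lattices.

(** * Complex tori *)

Section Torus.
Local Open Scope complex_scope.
Context {R : realType}.
Implicit Types (L : lattice R) (x y z : R[i]).

Lemma torus_piB L : {morph torus_pi L : x y / x - y}.
Proof. by move=> x y; rewrite /torus_pi; exact: raddfB. Qed.

Lemma torus_piMn L x n : torus_pi L (x *+ n) = torus_pi L x *+ n.
Proof. by rewrite /torus_pi; exact: raddfMn. Qed.

Lemma torus_pi0 L : torus_pi L 0 = 0.
Proof. by rewrite /torus_pi; exact: raddf0. Qed.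

Lemma torus_pi_eq0 L x : torus_pi L x = 0 <-> x \in in_lattice L.
Proof. by rewrite -{2}(subr0 x) -torus_pi_eq torus_pi0. Qed.

Lemma norm_cross x y : `|cross x y|%:C <= `|x| * `|y|.
Proof.
(* Up to sign, [cross x y] is the real part of i x conj(y). *)
have -> : `|x| * `|y| = `|x * (y^*%C * (0 +i* 1))|.
  rewrite !normrM normcJ [`|_ +i* _|]normc_def /=.
  by rewrite expr0n add0r expr1n sqrtr1 mulr1.
apply: le_trans (normc_ge_Re _); case: x y => [a b] [c d] /=.
rewrite /cross /= lecR le_eqVlt -normrN; apply/orP; left; apply/eqP.
by congr `|_|; ring.
Qed.

(** For z = a w1 + b w2, crossing with w2 and w1 gives a A and - b A, where A is the area. A nonzero
    one is at least A in absolute value, so [norm_cross] bounds |z| from below. *)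
Lemma lattice_discrete L :
  exists2 d : R[i], 0 < d & forall z, z \in in_lattice L -> `|z| < d -> z = 0.
Proof.
have A0 := cross_lattice_gt0 L; set A := cross _ _ in A0.
have n2 : 0 < `|w2 L| by rewrite normr_gt0 w2_neq0.
have n12 : 0 < `|w1 L| + `|w2 L| by rewrite ltr_wpDl.
exists (A%:C / (`|w1 L| + `|w2 L|)); first by rewrite divr_gt0 // ltcR.
move=> _ /in_latticeP[a [b ->]]; set z := _ + _ => hz.
have small (c : int) w : `|w| <= `|w1 L| + `|w2 L| ->
    `|cross z w| = `|c%:~R * A| -> c = 0.
  move=> hw e; apply/eqP/contraT => c0.
  have /lt_geF/negbT/negP[] : `|z| * (`|w1 L| + `|w2 L|) < A%:C.
    by rewrite -ltr_pdivlMr.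
  apply: le_trans (ler_wpM2l (normr_ge0 z) hw).
  apply: le_trans (norm_cross z w); rewrite e lecR normrM (gtr0_norm A0).
  by apply: (ler_peMl (ltW A0)); rewrite -intr_norm ler1z -gtz0_ge1 normr_gt0.
have a0 : a = 0.
  apply: (small _ (w2 L)); first by rewrite lerDr.
  have {1}-> : w2 L = 0%:~R * w1 L + 1%:~R * w2 L by ring.
  by rewrite /z cross_int mulr1 mulr0 subr0.
have b0 : b = 0.
  apply: (small _ (w1 L)); first by rewrite lerDl.
  have {1}-> : w1 L = 1%:~R * w1 L + 0%:~R * w2 L by ring.
  by rewrite /z cross_int mulr1 mulr0 sub0r rmorphN mulNr normrN.
by rewrite /z a0 b0 !mul0r addr0.
Qed.

(** If x is nonzero, its multiples fill the plane, including nonzero points too small for the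
    lattice. *)
Lemma lattice_absorb L x : (forall z, x * z \in in_lattice L) -> x = 0.
Proof.
have [d d0 dP] := lattice_discrete L.
move=> h; apply/eqP/contraT => x0.
have d2 : 0 < d / 2%:R by rewrite divr_gt0.
have := dP _ (h (x^-1 * (d / 2%:R))); rewrite mulVKf // gtr0_norm //.
rewrite ltr_pdivrMr // mulr_natr mulr2n ltrDl d0 => /(_ isT) e.
by rewrite e ltxx in d2.
Qed.

(** The value is independent of the representative [repr P] once k L is contained in L', as
    [mult_mapE] shows. *)
Definition mult_map (k : R[i]) L L' (P : torus L) : torus L' :=
  torus_pi L' (k * repr P).

Section MultMap.
Variables (k : R[i]) (L L' : lattice R).
Hypothesis kL : forall z, z \in in_lattice L -> k * z \in in_lattice L'.

Lemma mult_mapE z : mult_map k L L' (torus_pi L z) = torus_pi L' (k * z).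
Proof.
by apply/torus_pi_eq; rewrite -mulrBr; apply: kL; apply/torus_pi_eq;
   rewrite /torus_pi reprK.
Qed.

Lemma mult_map_isogeny : k != 0 -> isogeny (mult_map k L L').
Proof.
move=> k0; split.
- move=> P Q; have [x ->] := torus_pi_surj P; have [y ->] := torus_pi_surj Q.
  by rewrite -torus_piD !mult_mapE mulrDr torus_piD.
- move=> z0; exists (fun z => k * z); apply: (@nearW _ (nbhs (z0 : R[i]^o))) => z.
  split; last by rewrite mult_mapE.
  by apply: derivableM; [exact: derivable_cst|exact: derivable_id].
- apply: contrapT => H; move/eqP: k0; apply; apply: (@lattice_absorb L') => z.
  apply/torus_pi_eq0; apply: contrapT => h; apply: H.
  by exists (torus_pi L z); rewrite mult_mapE.
Qed.

End MultMap.

(** Positive elements of [R[i]] are real, so the Archimedean property of [R] applies. *)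
Lemma exp2_unbounded x (r : R[i]) : 0 < r -> exists n, `|x| < r * 2%:R ^+ n.
Proof.
case: r => r i; rewrite ltcE /= => /andP[/eqP-> r0].
rewrite normc_def; set a := Num.sqrt _.
exists (Num.bound (a / r)); rewrite -(natrX _ 2) -(rmorph_nat (real_complex R)).
rewrite -[r +i* 0]/(r%:C) -rmorphM ltcR mulrC -ltr_pdivrMr //.
apply: (lt_trans (archi_boundP _)); first by rewrite divr_ge0 ?sqrtr_ge0 // ltW.
by rewrite ltr_nat ltn_expl.
Qed.

(** The order of [R[i]] is partial, so a b / (a + b) replaces the minimum. *)
Lemma exists_common_radius {a b : R[i]} : 0 < a -> 0 < b ->
  exists c, [/\ 0 < c, c <= a & c <= b].
Proof.
move=> a0 b0; have ab0 : 0 < a + b by rewrite addr_gt0.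
exists (a * b / (a + b)); split; first by rewrite divr_gt0 // mulr_gt0.
  by rewrite ler_pdivrMr // ler_wpM2l ?lerDr ?(ltW a0).
by rewrite ler_pdivrMr // mulrC ler_wpM2l ?lerDl ?(ltW b0) ?(ltW a0).
Qed.

(* Near 0 a local lift g with g 0 = 0 satisfies g (2z) = 2 g z, both sides being
   close lifts of the same point; comparing g z = 2^n g (z / 2^n) with the
   derivative k at 0 gives g z = k z. *)
Lemma isogeny_linear {L L'} {phi : torus L -> torus L'} : isogeny phi ->
  exists k, forall z, phi (torus_pi L z) = torus_pi L' (k * z).
Proof.
case=> phiD phiH _; have [f] := phiH 0.
move=> nf; have [df _] := nbhs_singleton nf.
pose g (z : R[i]) : R[i] := f z - f 0.
pose k : R[i] := 'D_1 (f : R[i]^o -> R[i]^o) 0.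
have gk (e : R[i]) : 0 < e ->
    exists2 r : R[i], 0 < r & forall z, `|z| < r -> `|g z - k * z| <= e * `|z|.
  move=> e0; have /eqaddoP /(_ e e0) := derivable_nbhs df.
  rewrite -nbhs_nearE => /nbhs_norm0P[r r0 hr]; exists r => // z zr.
  have := hr z zr; rewrite /= -![(_ + _ : _ -> _) _]/(_ + _).
  rewrite -![(- _ : _ -> _) _]/(- _) -![(_ + _ : _ -> _) _]/(_ + _) /cst /=.
  by rewrite addr0 -[z%:A]/(z * 1) mulr1 -[z *: _]/(z * _) opprD addrA mulrC.
have phi0 : phi 0 = 0.
  by apply: (addrI (phi 0)); rewrite -phiD !addr0.
move: nf; rewrite -nbhs_nearE => /nbhs_norm0P[r1 r10 hr1].
have gpi z : `|z| < r1 -> torus_pi L' (g z) = phi (torus_pi L z).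
  move=> zr; have [_ e] := hr1 z zr.
  have [|_ e'] := hr1 0; first by rewrite /= normr0.
  by rewrite /g torus_piB e e' torus_pi0 phi0 subr0.
have g0 : g 0 = 0 by rewrite /g subrr.
have [r2 r20 hr2] := gk 1 ltr01.
have [d d0 hd] := lattice_discrete L'.
have K0 : 0 < `|k| + 1 by rewrite ltr_wpDl.
have gb z : `|z| < r2 -> `|g z| <= (`|k| + 1) * `|z|.
  move=> /hr2; rewrite mul1r => h.
  rewrite -(subrK (k * z) (g z)) mulrDl mul1r -normrM addrC.
  by apply: le_trans (ler_normD _ _) _; rewrite lerD2l.
have [r3 [r30 r31 r32]] := exists_common_radius r10 r20.
(* Below this radius g z and 2 g (z / 2) differ by less than d; being congruent modulo L', they are
   equal. *)
have d20 : 0 < d / ((`|k| + 1) *+ 2) by rewrite divr_gt0 // mulrn_wgt0.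
have [r [r0 hr3 hrd]] := exists_common_radius r30 d20.
have half z : `|z / 2%:R| <= `|z|.
  rewrite normrM normfV normr_nat ler_pdivrMr // mulr_natr mulr2n.
  by rewrite lerDl.
have ghalf z : `|z| < r -> g z = g (z / 2%:R) *+ 2.
  move=> zr; have z3 := lt_le_trans zr hr3.
  have h3 := le_lt_trans (half z) z3.
  apply/eqP; rewrite -subr_eq0; apply/eqP/hd.
    apply/torus_pi_eq; rewrite torus_piMn !gpi ?(lt_le_trans z3) //;
      last exact: lt_le_trans h3 _.
    rewrite mulr2n -phiD -torus_piD; congr (phi (torus_pi L _)).
    by rewrite -mulr2n -[_ / _ *+ 2]mulr_natr divfK // pnatr_eq0.
  apply: (@le_lt_trans _ _ ((`|k| + 1) * `|z| *+ 2)).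
    apply: le_trans (ler_normB _ _) _; rewrite [leRHS]mulr2n lerD //.
      by apply: gb; exact: lt_le_trans z3 _.
    rewrite normrMn -[`|_| *+ 2]mulr_natr -ler_pdivlMr //.
    apply: le_trans (gb _ _) _; first exact: lt_le_trans h3 _.
    by rewrite normrM normfV normr_nat mulrA.
  rewrite -mulrnAl mulrC -ltr_pdivlMr ?mulrn_wgt0 //.
  exact: lt_le_trans zr hrd.
have giter z n : `|z| < r -> g z = 2%:R ^+ n * g (z / 2%:R ^+ n).
  move=> zr; elim: n => [|n IHn]; first by rewrite expr0 divr1 mul1r.
  rewrite IHn ghalf; last first.
    apply: le_lt_trans zr; rewrite normrM normfV normrX normr_nat.
    rewrite ler_pdivrMr ?exprn_gt0 // ler_peMr // exprn_ege1 //.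
    by rewrite ler1n.
  have -> : z / 2%:R ^+ n.+1 = z / 2%:R ^+ n / 2%:R.
    by rewrite exprSr invfM mulrA.
  by rewrite exprSr -[RHS]mulrA mulr_natl.
have glin z : `|z| < r -> g z = k * z.
  move=> zr; apply/eqP; rewrite -subr_eq0; apply/contraT => ne.
  have z0 : 0 < `|z|.
    by rewrite normr_gt0; apply: contraNneq ne => ->; rewrite g0 mulr0 subrr.
  have n0 : 0 < `|g z - k * z| by rewrite normr_gt0.
  (* With this bound, the estimate at z / 2^n makes |g z - k z| at most half of itself. *)
  have e0 : 0 < `|g z - k * z| / (`|z| * 2%:R) by rewrite divr_gt0 ?mulr_gt0.
  have [s s0 hs] := gk _ e0.
  have [n hn] := exp2_unbounded z s s0.
  have p0 : 0 < 2%:R ^+ n :> R[i] by rewrite exprn_gt0.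
  have := hs (z / 2%:R ^+ n).
  rewrite normrM normfV normrX normr_nat ltr_pdivrMr // => /(_ hn).
  have -> : g (z / 2%:R ^+ n) - k * (z / 2%:R ^+ n) = (g z - k * z) / 2%:R ^+ n.
    by rewrite mulrBl (giter z n) // [_ * g _]mulrC mulfK ?gt_eqF // mulrA.
  rewrite normrM normfV normrX normr_nat.
  have -> : `|g z - k * z| / (`|z| * 2%:R) * (`|z| / 2%:R ^+ n) =
      `|g z - k * z| / 2%:R ^+ n / 2%:R.
    by field; rewrite !gt_eqF.
  rewrite ler_pdivlMr // mulr_natr mulr2n gerDl => /le_gtF.
  by rewrite divr_gt0.
exists k => z.
have [n hn] := exp2_unbounded z r r0.
have p0 : 0 < 2%:R ^+ n :> R[i] by rewrite exprn_gt0.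
have zn : `|z / 2%:R ^+ n| < r.
  by rewrite normrM normfV normrX normr_nat ltr_pdivrMr.
have phiMn P j : phi (P *+ j) = phi P *+ j.
  by elim: j => [|j IHj]; rewrite ?mulr0n // !mulrS phiD IHj.
have zE : z = (z / 2%:R ^+ n) *+ (2 ^ n).
  by rewrite -[RHS]mulr_natr natrX divfK // gt_eqF.
rewrite {1}zE torus_piMn phiMn -gpi; last first.
  exact: lt_le_trans zn (le_trans hr3 _).
by rewrite glin // -torus_piMn -mulrnAr -zE.
Qed.
End Torus.

(** * Multiplication maps with cyclic kernel; isomorphisms as homotheties *)

Section Isogenies.
Local Open Scope complex_scope.
Context {R : realType}.
Implicit Types (L : lattice R) (x y z k : R[i]).

Lemma intr_absz (n : int) : 0 <= n -> n%:~R = (`|n|%N)%:R :> R[i].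
Proof. by move=> n0; rewrite -{1}(gez0_abs n0) pmulrn. Qed.

Section CyclicKernel.
Context {L L' : lattice R} {k x y x' y' : R[i]} {m : nat}.
Hypotheses (m0 : (0 < m)%N) (k0 : k != 0).
Hypotheses (Lxy : is_basis L x y) (Lxy' : is_basis L' x' y').
Hypotheses (kx : k * x = m%:R * x') (ky : k * y = y').

Lemma mult_basis z : z \in in_lattice L -> k * z \in in_lattice L'.
Proof.
move=> /(proj2 Lxy)[a [b ->]]; apply/(proj2 Lxy').
exists (a * m%:Z), b.
by rewrite mulrDr !mulrA ![k * _%:~R]mulrC -!mulrA kx ky rmorphM /= mulrA.
Qed.

Let P := torus_pi L (x / m%:R).

(** Since k (x / m) = x' and k y = y', the preimage of a x' + b y' is a (x / m) + b y. Modulo L only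
    the remainder of a modulo m matters, which provides the natural coefficient required by
    [multiples]. *)
Lemma mult_map_kernel :
  kerset (mult_map k L L') = multiples P.
Proof.
have mC : m%:R != 0 :> R[i] by rewrite pnatr_eq0 -lt0n.
have mZ : m%:Z != 0 by rewrite eqz_nat -lt0n.
have x'E : x' = k * x / m%:R by rewrite kx [m%:R * _]mulrC mulfK.
apply/seteqP; split=> [Q|_ [n _ <-]].
  have [z ->] := torus_pi_surj Q; rewrite /kerset /= mult_mapE; last exact: mult_basis.
  move=> /torus_pi_eq0/(proj2 Lxy')[a [b e]].
  exists `|(a %% m%:Z)%Z|%N => //; rewrite -torus_piMn; apply/torus_pi_eq.
  apply/(proj2 Lxy); exists (- (a %/ m%:Z)%Z), (- b).
  have -> : z = a%:~R * (x / m%:R) + b%:~R * y.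
    by apply: (mulfI k0); rewrite e -ky x'E; ring.
  have -> : a%:~R = (a %/ m%:Z)%Z%:~R * m%:R + (a %% m%:Z)%Z%:~R :> R[i].
    by rewrite {1}(divz_eq a m) rmorphD rmorphM.
  rewrite -[_ *+ `|_|%N]mulr_natl -intr_absz ?modz_ge0 // !rmorphN /=.
  by field.
rewrite /kerset /= -torus_piMn mult_mapE; last exact: mult_basis.
apply/torus_pi_eq0/(proj2 Lxy'); exists n%:Z, 0.
by rewrite x'E -[_ *+ n]mulr_natr -pmulrn; field.
Qed.

(** Equality puts (i - j) x / m into L, so m divides i - j, which is smaller than m in absolute
    value. *)
Lemma mult_map_kernel_order (i j : nat) : (i < m)%N -> (j < m)%N ->
  P *+ i = P *+ j -> i = j.
Proof.
have mC : m%:R != 0 :> R[i] by rewrite pnatr_eq0 -lt0n.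
move=> im jm; rewrite -!torus_piMn => /torus_pi_eq/(proj2 Lxy)[a [b e]].
have /(cross_free (proj1 Lxy))[h _] :
    (i%:Z - j%:Z)%:~R * x + 0%:~R * y = (a * m%:Z)%:~R * x + (b * m%:Z)%:~R * y.
  transitivity (m%:R * (x / m%:R *+ i - x / m%:R *+ j)).
    by rewrite -![x / _ *+ _]mulr_natl rmorphB /= -!pmulrn; field.
  by rewrite e !rmorphM /= -!pmulrn; ring.
have a0 : a = 0 by nia.
by move: h; rewrite a0; lia.
Qed.

Lemma mult_map_degree : isogeny_of_degree m (mult_map k L L').
Proof.
split; first by apply: mult_map_isogeny => //; exact: mult_basis.
rewrite mult_map_kernel.
have -> : multiples P = ((fun i => P *+ i) @` `I_m)%classic.
  apply/seteqP; split=> [_ [n _ <-]|_ [i _ <-]]; last by exists i.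
  exists (n %% m)%N; first by rewrite /= ltn_pmod.
  have Pm : P *+ m = 0.
    rewrite -torus_piMn; apply/torus_pi_eq0/(proj2 Lxy); exists 1, 0.
    rewrite -[_ *+ m]mulr_natr divfK ?pnatr_eq0 -?lt0n //; ring.
  by rewrite {2}(divn_eq n m) mulrnDr mulnC mulrnA Pm mul0rn add0r.
apply: inj_card_eq => i j; rewrite !inE => im jm.
exact: mult_map_kernel_order.
Qed.

End CyclicKernel.

(** [phi] is multiplication by some k, and its inverse makes k z in L' imply z in L. *)
Lemma enhanced_iso_scale (N : nat) (G : level_kind) (e e' : enhanced R N G) :
  enhanced_iso e e' -> exists k, forall z,
    z \in in_lattice (curve e) <-> k * z \in in_lattice (curve e').
Proof.
move=> [phi [psi [iphi ipsi phiK psiK _]]].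
have [k hk] := isogeny_linear iphi.
have [l hl] := isogeny_linear ipsi.
have phi0 : phi 0 = 0.
  by case: iphi => D _ _; apply: (addrI (phi 0)); rewrite -D !addr0.
have psi0 : psi 0 = 0.
  by case: ipsi => D _ _; apply: (addrI (psi 0)); rewrite -D !addr0.
exists k => z; split=> /torus_pi_eq0 h; apply/torus_pi_eq0.
  by rewrite -hk h.
by rewrite -[LHS]phiK hk h psi0.
Qed.

Lemma scale_basis L L' k x y : k != 0 ->
  (forall z, z \in in_lattice L <-> k * z \in in_lattice L') ->
  is_basis L x y -> is_basis L' (k * x) (k * y).
Proof.
move=> k0 kP [xy0 xyP]; split.
  by rewrite cross_scale mulf_neq0 // gt_eqF ?normsq_gt0.
move=> z; have -> : z = k * (z / k) by rewrite mulrC divfK.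
rewrite -kP xyP; split=> -[a [b h]]; exists a, b.
  by rewrite h; ring.
by apply: (mulfI k0); rewrite h; ring.
Qed.

End Isogenies.

(** * Level structures *)

Section Levels.
Local Open Scope complex_scope.
Context {R : realType}.
Implicit Types (L : lattice R) (x y z k : R[i]).

Lemma expiD (s t : R) : expi (s + t) = expi s * expi t.
Proof.
by rewrite /expi cosD sinD; apply/eqP; rewrite eq_complex /= eqxx addrC eqxx.
Qed.

Lemma expi_2pi_nat (n : nat) : expi (2%:R * pi * n%:R) = 1 :> R[i].
Proof.
elim: n => [|n IHn]; first by rewrite mulr0 /expi cos0 sin0.
by rewrite -[n.+1%:R]natr1 mulrDr mulr1 expiD IHn mul1r /expi mulr_natl cos2pi sin2pi.
Qed.

Lemma expi_2pi_int (n : int) : expi (2%:R * pi * n%:~R) = 1 :> R[i].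
Proof.
case: n => n; first exact: expi_2pi_nat.
rewrite NegzE rmorphN /= mulrN -[LHS]mulr1 -(expi_2pi_nat n.+1) -expiD addNr.
by rewrite expi_2pi_nat /expi cos0 sin0.
Qed.

Definition torsion_point L (N : nat) (a b : int) : torus L :=
  torus_pi L ((a%:~R * w1 L + b%:~R * w2 L) / N%:R).

Lemma torsion_pointD L N (a b c d : int) :
  torsion_point L N a b + torsion_point L N c d = torsion_point L N (a + c) (b + d).
Proof.
by rewrite -torus_piD; congr torus_pi; rewrite !rmorphD /=; ring.
Qed.

Lemma torsion_pointMn L N (a b : int) (n : nat) :
  torsion_point L N a b *+ n = torsion_point L N (n%:Z * a) (n%:Z * b).
Proof.
rewrite -torus_piMn; congr torus_pi.
by rewrite -[_ *+ n]mulr_natl !rmorphM /= -pmulrn; ring.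
Qed.

Section FixedN.
Context {N : nat} (N0 : (0 < N)%N).

Lemma torsion_point_eq L (a b c d : int) :
  torsion_point L N a b = torsion_point L N c d <->
  (N%:Z %| a - c)%Z /\ (N%:Z %| b - d)%Z.
Proof.
have NC : N%:R != 0 :> R[i] by rewrite pnatr_eq0 -lt0n.
have e0 : (a%:~R * w1 L + b%:~R * w2 L) / N%:R -
    (c%:~R * w1 L + d%:~R * w2 L) / N%:R =
    ((a - c)%:~R * w1 L + (b - d)%:~R * w2 L) / N%:R.
  by rewrite !rmorphB /=; ring.
rewrite torus_pi_eq e0; split=> [/in_latticeP[p [q e]]|[]].
  have /(cross_free (proj1 (is_basis_w L)))[-> ->] :
      (a - c)%:~R * w1 L + (b - d)%:~R * w2 L =
      (p * N%:Z)%:~R * w1 L + (q * N%:Z)%:~R * w2 L.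
    apply: (mulIf (invr_neq0 NC)); rewrite e !rmorphM /= -!pmulrn.
    by field.
  by rewrite !dvdz_mull.
move=> /dvdzP[p ->] /dvdzP[q ->]; apply/in_latticeP; exists p, q.
by rewrite !rmorphM /= -!pmulrn; field.
Qed.

Lemma torsion_pointP L (T : torus L) : T *+ N = 0 ->
  exists a b, T = torsion_point L N a b.
Proof.
have NC : N%:R != 0 :> R[i] by rewrite pnatr_eq0 -lt0n.
have [z ->] := torus_pi_surj T; rewrite -torus_piMn.
move=> /torus_pi_eq0/in_latticeP[a [b e]]; exists a, b; rewrite /torsion_point -e.
by rewrite -[_ *+ N]mulr_natr mulfK.
Qed.

Lemma torsion_basis_points L {a b c d : int} :
  (N%:Z %| a * d - b * c - 1)%Z ->
  torsion_basis N (torsion_point L N a b) (torsion_point L N c d).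
Proof.
have t0 : torsion_point L N 0 0 = 0.
  by rewrite /torsion_point !mul0r addr0 mul0r torus_pi0.
move=> /dvdzP[t det].
have tN p q : torsion_point L N p q *+ N = 0.
  by rewrite torsion_pointMn -t0 torsion_point_eq !subr0 !dvdz_mulr.
split=> // T /torsion_pointP[p [q ->]].
have NZ : N%:Z != 0 by rewrite eqz_nat -lt0n.
have red (x : int) : exists i : 'I_N, (N%:Z %| x - i%:Z)%Z.
  have lt : (`|(x %% N%:Z)%Z|%N < N)%N.
    by rewrite -ltz_nat gez0_abs ?modz_ge0 // ltz_pmod.
  exists (Ordinal lt); rewrite /= gez0_abs ?modz_ge0 //.
  by rewrite {1}(divz_eq x N%:Z) addrK dvdz_mull.
(* Cramer's rule: the adjugate matrix applied to (p, q) gives the coordinates modulo N. *)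
have [i /dvdzP[i' iE]] := red (p * d - q * c).
have [j /dvdzP[j' jE]] := red (a * q - b * p).
exists (i, j); split=> [|[i1 j1]] /=; rewrite !torsion_pointMn torsion_pointD.
  apply/torsion_point_eq; split; apply/dvdzP.
    exists (i' * a + j' * c - t * p).
    rewrite [RHS](_ : _ = (i' * N%:Z) * a + (j' * N%:Z) * c - (t * N%:Z) * p); last by ring.
    by rewrite -iE -jE -det; ring.
  exists (i' * b + j' * d - t * q).
  rewrite [RHS](_ : _ = (i' * N%:Z) * b + (j' * N%:Z) * d - (t * N%:Z) * q); last by ring.
  by rewrite -iE -jE -det; ring.
move=> /torsion_point_eq[/dvdzP[f fE] /dvdzP[g gE]].
have inj (x y : 'I_N) (h : int) : x%:Z - y%:Z = h * N%:Z -> x = y.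
  move=> e; apply/val_inj => /=; have := ltn_ord x; have := ltn_ord y.
  have : h = 0 by have := ltn_ord x; have := ltn_ord y; nia.
  by move=> h0; move: e; rewrite h0; lia.
(* Uniqueness applies the same adjugate to [fE] and [gE]; the terms in t correct for the determinant
   1 + t N. *)
congr pair.
  apply: (inj _ _ (f * d - g * c - i' + t * i1%:Z)).
  rewrite [RHS](_ : _ = (f * N%:Z) * d - (g * N%:Z) * c - i' * N%:Z +
    (t * N%:Z) * i1%:Z); last by ring.
  by rewrite -fE -gE -iE -det; ring.
apply: (inj _ _ (g * a - f * b - j' + t * j1%:Z)).
rewrite [RHS](_ : _ = (g * N%:Z) * a - (f * N%:Z) * b - j' * N%:Z +
  (t * N%:Z) * j1%:Z); last by ring.
by rewrite -fE -gE -jE -det; ring.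
Qed.

(** If k Q = 0 with 0 < k < N, the pairs (0, 0) and (0, k) would both represent 0. *)
Lemma torsion_basis_order {V : zmodType} {P Q : V} :
  torsion_basis N P Q -> has_order Q N.
Proof.
move=> [_ QN PQ]; split=> // k /andP[k0 kN] Qk.
have [i [_ iu]] := PQ 0 (mul0rn _ _).
have e1 := iu (Ordinal N0, Ordinal N0).
have e2 := iu (Ordinal N0, Ordinal kN).
have := etrans (esym (e1 _)) (e2 _); rewrite /= !mulr0n Qk !addr0.
by move=> /(_ erefl erefl)[] kk; rewrite -kk in k0.
Qed.

(* Q rather than P for Gamma1 and Gamma0: an isogeny of level Gamma(N) maps Q to
   Q' and P to [m]P', so the same maps work for the three kinds of level. *)
Definition basis_level (G : level_kind) (V : zmodType) (P Q : V) : level_data G V :=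
  match G with
  | GammaFull => (P, Q)
  | Gamma1 => Q
  | Gamma0 => multiples Q
  end.

Lemma basis_levelP (G : level_kind) L {a b c d : int} :
  (N%:Z %| a * d - b * c - 1)%Z ->
  is_level_structure N
    (basis_level G _ (torsion_point L N a b) (torsion_point L N c d)).
Proof.
move=> det; have tb := torsion_basis_points L det.
have o := torsion_basis_order tb.
case: G => //=; last by exists (torsion_point L N c d).
split=> //; exists a, b, c, d; split=> //.
have NR : N%:R != 0 :> R by rewrite pnatr_eq0 -lt0n.
have /dvdzP[t e] := det.
(* The excess t N of the determinant over 1 adds 2 pi t to the angle, which leaves the pairing
   unchanged. *)
have -> : a * d - b * c = 1 + t * N%:Z by rewrite -e; ring.
rewrite rmorphD rmorphM /= -pmulrn.
have -> : 2%:R * pi * (1 + t%:~R * N%:R) / N%:R = 2%:R * pi / N%:R + 2%:R * pi * t%:~R :> R.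
  by field.
by rewrite expiD expi_2pi_int mulr1.
Qed.

Lemma image_multiples (V W : zmodType) (phi : V -> W) (Q : V) :
  additive_map phi -> (phi @` multiples Q)%classic = multiples (phi Q).
Proof.
move=> D; have phiMn j : phi (Q *+ j) = phi Q *+ j.
  elim: j => [|j IHj]; last by rewrite !mulrS D IHj.
  by rewrite !mulr0n; apply: (addrI (phi 0)); rewrite -D !addr0.
apply/seteqP; split=> [_ [_ [n _ <-] <-]|_ [n _ <-]].
  by exists n => //; rewrite phiMn.
by exists (Q *+ n); [exists n|rewrite phiMn].
Qed.

Lemma preserves_basis_level (m : nat) (G : level_kind) (V W : zmodType)
    (phi : V -> W) (P Q : V) (P' Q' : W) : additive_map phi ->
  phi P = P' *+ m -> phi Q = Q' ->
  preserves_level m phi (basis_level G V P Q) (basis_level G W P' Q').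
Proof.
by move=> D hP hQ; case: G => //=; rewrite image_multiples // hQ.
Qed.

End FixedN.
End Levels.

(** * Isogenous lattices of index m *)

Section Neighbours.
Local Open Scope complex_scope.
Context {R : realType}.
Context {N : nat} (N0 : (0 < N)%N) (G : level_kind).
Implicit Types (L : lattice R) (x y z k : R[i]).

(** The identity matrix, which yields the level structure built on w1 / N and w2 / N. *)
Lemma dvdz_det_std : (N%:Z %| 1 * 1 - 0 * 0 - 1)%Z.
Proof. by rewrite mulr1 mulr0 subr0 subrr dvdz0. Qed.

Definition standard_enhanced L : enhanced R N G :=
  Enhanced (basis_levelP N0 G L dvdz_det_std).

(** Bezout gives a m = 1 modulo N, so Q = a (m Q). *)
Lemma multiples_coprime (V : zmodType) (Q : V) (m : nat) : (0 < m)%N ->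
  coprime m N -> Q *+ N = 0 -> multiples (Q *+ m) = multiples Q.
Proof.
move=> m0 co QN; apply/seteqP; split=> [_ [i _ <-]|_ [i _ <-]].
  by exists (m * i)%N; rewrite ?mulrnA.
case: (egcdnP N m0) => a b e _.
exists (a * i)%N => //; rewrite -mulrnA mulnA [(m * a)%N]mulnC e (eqP co).
by rewrite mulnDl mulrnDr mul1n -mulnA mulnCA mulrnA QN mul0rn add0r.
Qed.

Lemma cross_divn x y (m : nat) : cross (x / m%:R) y = cross x y / m%:R.
Proof.
rewrite /cross -(rmorph_nat (real_complex R)) -fmorphV /=.
by case: x y (m%:R^-1) => [a b] [c d] e /=; ring.
Qed.

Section Neighbour.
Context (L : lattice R) {m : nat} {u v r s : int}.
Hypotheses (m0 : (0 < m)%N) (mN : coprime m N) (det : u * s - v * r = 1).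

Let x : R[i] := u%:~R * w1 L + v%:~R * w2 L.
Let y : R[i] := r%:~R * w1 L + s%:~R * w2 L.

Lemma neighbour_oriented : 0 < complex.Im (x / m%:R / y).
Proof.
apply: oriented_of_cross.
by rewrite cross_divn cross_int det mul1r divr_gt0 ?cross_lattice_gt0 // ltr0n.
Qed.

(** As x, y is a basis of L, this lattice is L + Z x / m. *)
Definition neighbour : lattice R := Lattice neighbour_oriented.

Let Lxy : is_basis L x y := is_basis_sl2 det (is_basis_w L).
Let L'xy : is_basis neighbour (x / m%:R) y := is_basis_w neighbour.

Let mC : m%:R != 0 :> R[i]. Proof. by rewrite pnatr_eq0 -lt0n. Qed.
Let NC : N%:R != 0 :> R[i]. Proof. by rewrite pnatr_eq0 -lt0n. Qed.

Let detC : u%:~R * s%:~R - v%:~R * r%:~R = 1 :> R[i].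
Proof. by rewrite -!rmorphM -rmorphB det. Qed.

Let w1E : w1 L = s%:~R * x - v%:~R * y.
Proof. by rewrite -[LHS]mul1r -{1}detC /x /y; ring. Qed.

Let w2E : w2 L = u%:~R * y - r%:~R * x.
Proof. by rewrite -[LHS]mul1r -{1}detC /x /y; ring. Qed.

Context {n : int}.
Hypothesis nm : (N%:Z %| n * m%:Z - 1)%Z.

(** In the basis x / m, y of the neighbour, w1 is (s m, - v) and w2 is (- r m, u). The point Q' is
    w2 / N, and P' is n w1 / N, n being the inverse of m modulo N, so that m P' = w1 / N. *)
Lemma neighbour_det :
  (N%:Z %| (n * s * m%:Z) * u - (- n * v) * (- r * m%:Z) - 1)%Z.
Proof.
rewrite (_ : _ - 1 = n * m%:Z * (u * s - v * r) - 1); last by ring.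
by rewrite det mulr1.
Qed.

Definition neighbour_enhanced : enhanced R N G :=
  Enhanced (basis_levelP N0 G neighbour neighbour_det).

Lemma to_neighbour :
  cyclic_isogeny m (standard_enhanced L) neighbour_enhanced.
Proof.
have hx : 1 * x = m%:R * (x / m%:R) by field.
have hy := mul1r y.
have kL := mult_basis Lxy L'xy hx hy.
have deg := mult_map_degree m0 (oner_neq0 _) Lxy L'xy hx hy.
exists (mult_map 1 L neighbour); split; last first.
  by eexists; exact: (mult_map_kernel m0 (oner_neq0 _) Lxy L'xy hx hy).
split=> //; apply: preserves_basis_level; first by case: deg => -[].
  rewrite torsion_pointMn mult_mapE //.
  transitivity (torsion_point neighbour N (s * m%:Z) (- v)).
    congr torus_pi; rewrite w1E !rmorphN !rmorphM /= -!pmulrn; field.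
    by rewrite mC NC.
  move/dvdzP: nm => [t e].
  apply/torsion_point_eq => //; split; apply/dvdzP.
    exists (- (t * s * m%:Z)).
    rewrite [RHS](_ : _ = - ((t * N%:Z) * s * m%:Z)); last by ring.
    by rewrite -e; ring.
  exists (t * v).
  rewrite [RHS](_ : _ = (t * N%:Z) * v); last by ring.
  by rewrite -e; ring.
rewrite mult_mapE //; congr torus_pi.
rewrite w2E !(rmorphM, rmorphN) /= -!pmulrn; field.
by rewrite mC NC.
Qed.

(* Multiplication by eps * m with eps = 1 or -1 congruent to m: up to sign, the
   isogeny dual to the one of to_neighbour. *)
Lemma from_neighbour :
  (m%:Z = 1 %[mod N%:Z])%Z \/ (m%:Z = -1 %[mod N%:Z])%Z \/ G = Gamma0 ->
  cyclic_isogeny m neighbour_enhanced (standard_enhanced L).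
Proof.
move=> hG.
suff main (eps : int) : eps * eps = 1 ->
    (N%:Z %| m%:Z - eps)%Z \/ eps = 1 /\ G = Gamma0 ->
    cyclic_isogeny m neighbour_enhanced (standard_enhanced L).
  case: hG => [/eqP|[/eqP|hG]].
  - by rewrite eqz_mod_dvd => h; exact: (main 1 erefl (or_introl h)).
  - by rewrite eqz_mod_dvd => h; exact: (main (-1) erefl (or_introl h)).
  - exact: (main 1 erefl (or_intror (conj erefl hG))).
move=> eps2 heps.
(* The roles of x and y are exchanged: k maps y to m (eps y) and - x / m to - eps x. *)
have bas' := @is_basis_sl2 _ _ _ _ 0 1 (-1) 0 erefl L'xy.
have deteps : 0 * 0 - eps * (- eps) = 1 by rewrite mulrN sub0r opprK.
have bas := is_basis_sl2 deteps Lxy.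
pose k : R[i] := eps%:~R * m%:R.
have e2 : eps%:~R * eps%:~R = 1 :> R[i] by rewrite -rmorphM eps2.
have k0 : k != 0.
  rewrite mulf_neq0 //; apply/eqP => e0; move: e2.
  by rewrite e0 mulr0 => /esym/eqP; rewrite oner_eq0.
have hx : k * (0%:~R * (x / m%:R) + 1%:~R * y) =
    m%:R * (0%:~R * x + eps%:~R * y) by rewrite /k; ring.
have hy : k * ((-1)%:~R * (x / m%:R) + 0%:~R * y) =
    (- eps)%:~R * x + 0%:~R * y.
  by rewrite /k !rmorphN /=; field.
have kL := mult_basis bas' bas hx hy.
have deg := mult_map_degree m0 k0 bas' bas hx hy.
exists (mult_map k neighbour L); split; last first.
  by eexists; exact: (mult_map_kernel m0 k0 bas' bas hx hy).
split=> //.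
have hQ : mult_map k neighbour L (torsion_point neighbour N (- r * m%:Z) u) =
    torsion_point L N 0 (eps * m%:Z).
  rewrite mult_mapE //; congr torus_pi.
  rewrite w2E /k !rmorphM /= !rmorphN -!pmulrn /=; field.
  by rewrite mC NC.
(* If m = eps modulo N, then eps m = 1 and eps m n = m modulo N, so Q' goes to Q and P' to m P.
   Otherwise, for [Gamma0], Q' goes to m Q, which generates the same subgroup as Q. *)
case: heps => [em|[e1 G0]].
  apply: preserves_basis_level; first by case: deg => -[].
    rewrite torsion_pointMn mult_mapE //.
    transitivity (torsion_point L N (eps * m%:Z * n) 0).
      congr torus_pi; rewrite w1E /k !rmorphM /= !rmorphN -!pmulrn; field.
      by rewrite mC NC.
    apply/torsion_point_eq => //; split; last by rewrite mulr0 subr0 dvdz0.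
    move/dvdzP: nm em => [t e] /dvdzP[t' e']; apply/dvdzP; exists (eps * t - t').
    rewrite [RHS](_ : _ = eps * (t * N%:Z) - t' * N%:Z); last by ring.
    by rewrite -e -e'; ring.
  rewrite hQ; apply/torsion_point_eq => //; split; first by rewrite subrr dvdz0.
  rewrite (_ : _ - 1 = eps * (m%:Z - eps)); first by rewrite dvdz_mull.
  by rewrite mulrBr eps2.
have D : additive_map (mult_map k neighbour L) by case: deg => -[].
move: hQ; rewrite e1 mul1r => hQ.
have levQ : (mult_map k neighbour L @`
    multiples (torsion_point neighbour N (- r * m%:Z) u))%classic =
    multiples (torsion_point L N 0 1).
  rewrite image_multiples // hQ.
  have -> : torsion_point L N 0 m%:Z = torsion_point L N 0 1 *+ m.
    by rewrite torsion_pointMn mulr0 mulr1.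
  apply: multiples_coprime => //; rewrite torsion_pointMn mulr0 mulr1.
  have -> : 0 = torsion_point L N 0 0.
    by rewrite /torsion_point !mul0r addr0 mul0r torus_pi0.
  by apply/torsion_point_eq => //; rewrite !subr0 dvdz0 dvdzz.
by rewrite /standard_enhanced /neighbour_enhanced /= G0.
Qed.

End Neighbour.
End Neighbours.

(** * Lattices without complex multiplication *)

Section Generic.
Local Open Scope complex_scope.
Context {R : realType}.
Implicit Types (L : lattice R) (x y z k : R[i]).

Definition no_complex_mult L : Prop := forall k,
  (forall z, z \in in_lattice L -> k * z \in in_lattice L) ->
  exists q : int, k = q%:~R.

Lemma normsq_int (q : int) : normsq (q%:~R : R[i]) = (q ^+ 2)%:~R.
Proof. by rewrite intcE /normsq /= expr0n addr0 rmorphXn. Qed.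

Lemma normsqM x y : normsq (x * y) = normsq x * normsq y.
Proof. by rewrite /normsq; case: x y => [a b] [c d] /=; ring. Qed.

Lemma normsq_mul_nat {m : nat} {k} {q : int} : m%:R * k = q%:~R ->
  m%:R ^+ 2 * normsq k = (q ^+ 2)%:~R.
Proof.
move=> e; rewrite -normsq_int -e normsqM; congr (_ * _).
by rewrite -[m%:R in RHS]/((m%:Z)%:~R) normsq_int rmorphXn.
Qed.

(** For nonzero a the 2-adic valuations of the two sides have different parity. *)
Lemma sqr_eq_8sqr (a t : int) : t ^+ 2 = 8 * a ^+ 2 -> a = 0.
Proof.
move=> e; apply/eqP/contraT => a0.
have : (`|t| ^ 2 = 2 ^ 3 * `|a| ^ 2)%N.
  by move/(congr1 absz): e; rewrite abszM !abszX.
have a1 : (0 < `|a|)%N by rewrite absz_gt0.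
move/(congr1 (logn 2)); rewrite lognM ?expn_gt0 ?a1 // pfactorK // !lognX.
by move: (logn 2 `|t|) (logn 2 `|a|) => i j; lia.
Qed.

(* The lattices spanned by sqrt 2 + (j + 1) i and 1 have no complex
   multiplication since sqrt 2 is irrational, and are pairwise not homothetic. *)
Lemma generic_oriented (j : nat) :
  0 < complex.Im ((Num.sqrt 2%:R +i* j.+1%:R) / (1 : R[i])).
Proof. by rewrite divr1 /= ltr0n. Qed.

Definition generic_lattice (j : nat) : lattice R := Lattice (generic_oriented j).

Lemma cross_generic j : cross (w1 (generic_lattice j)) (w2 (generic_lattice j)) = j.+1%:R.
Proof. by rewrite /cross /= mulr1 mulr0 subr0. Qed.

Lemma generic_no_complex_mult j : no_complex_mult (generic_lattice j).
Proof.
move=> k hk.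
have s2 : Num.sqrt 2%:R ^+ 2 = 2%:R :> R by rewrite sqr_sqrtr // ler0n.
have in1 : w2 (generic_lattice j) \in in_lattice (generic_lattice j).
  by apply/in_latticeP; exists 0, 1; ring.
have in2 : w1 (generic_lattice j) \in in_lattice (generic_lattice j).
  by apply/in_latticeP; exists 1, 0; ring.
have /in_latticeP[a [b kE]] := hk _ in1.
have /in_latticeP[c [d]] := hk _ in2.
(* Since w2 = 1, k = a w1 + b; the imaginary part of k w1 = c w1 + d, divided by j + 1, reads 2 a
   sqrt 2 = c - b. *)
rewrite /= mulr1 in kE; rewrite {}kE !intcE => /(congr1 (@complex.Im R)) /= e.
have J0 : j.+1%:R != 0 :> R by rewrite pnatr_eq0.
have e' : (2 * a)%:~R * Num.sqrt 2%:R = (c - b)%:~R :> R.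
  by apply: (mulIf J0); rewrite rmorphB rmorphM /=; lra.
have a0 : a = 0.
  have e2 : ((c - b) ^+ 2)%:~R = (8 * a ^+ 2)%:~R :> R.
    rewrite rmorphXn /= -e' exprMn s2 !rmorphM /=.
    by ring.
  exact: sqr_eq_8sqr (intr_inj e2).
by exists b; rewrite a0 -!intcE; ring.
Qed.

(** The imaginary part of c w1 + d is the integer c (j + 1); if it vanishes, the point is the
    nonzero integer d. *)
Lemma normsq_generic_ge1 j z : z \in in_lattice (generic_lattice j) ->
  z != 0 -> 1 <= normsq z.
Proof.
move=> /in_latticeP[c [d ->]] z0.
have -> : normsq (c%:~R * w1 (generic_lattice j) + d%:~R * w2 (generic_lattice j)) =
    (c%:~R * Num.sqrt 2%:R + d%:~R) ^+ 2 + (c * j.+1%:Z)%:~R ^+ 2.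
  rewrite !intcE /normsq /= rmorphM /= -pmulrn; ring.
have [c0|c0] := eqVneq c 0; last first.
  apply: ler_wpDl; first exact: sqr_ge0.
  by rewrite -rmorphXn /= ler1z -gtz0_ge1 exprn_even_gt0 //= mulf_neq0.
rewrite c0 !mul0r add0r expr0n addr0 -rmorphXn /= ler1z -gtz0_ge1.
rewrite exprn_even_gt0 //=; apply: contraNneq z0 => d0.
by rewrite c0 d0 !mul0r addr0.
Qed.

Section Iso.
Context {L L' : lattice R} {k : R[i]}.
Hypothesis kP : forall z, z \in in_lattice L <-> k * z \in in_lattice L'.

Lemma scale_neq0 : k != 0.
Proof.
apply/eqP => k0; have : (1 : R[i]) = 0.
  apply: (@lattice_absorb _ L) => z; apply/kP.
  by rewrite k0 mul0r rpred0.
by move/eqP; rewrite oner_eq0.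
Qed.

Lemma scale_area :
  normsq k * cross (w1 L) (w2 L) = cross (w1 L') (w2 L').
Proof.
have k0 := scale_neq0.
rewrite -cross_scale; apply: (is_basis_cross L').
- exact: scale_basis kP (is_basis_w L).
- exact: is_basis_w.
- by rewrite cross_scale mulr_gt0 ?normsq_gt0 ?cross_lattice_gt0.
- exact: cross_lattice_gt0.
Qed.

End Iso.

(** As w2 = 1, k is itself a nonzero point of the second lattice, so |k|^2 >= 1; and |k|^2 is the
    ratio of the areas j + 1 and i + 1. *)
Lemma generic_scale_le i j k :
  (forall z, z \in in_lattice (generic_lattice i) <->
     k * z \in in_lattice (generic_lattice j)) -> (i <= j)%N.
Proof.
move=> kP; have := scale_area kP; rewrite !cross_generic => e.
have k0 := scale_neq0 kP.
rewrite -ltnS -(ler_nat R) -e ler_peMl ?ler0n //.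
apply: (normsq_generic_ge1 j) => //.
rewrite -[k]mulr1 -[1]/(w2 (generic_lattice i)); apply/kP.
by apply/in_latticeP; exists 0, 1; ring.
Qed.

Section Neighbour.
Context (L : lattice R) {m : nat} {u v r s : int}.
Hypotheses (m0 : (0 < m)%N) (det : u * s - v * r = 1).
Let L' := neighbour L m0 det.

Let mC : m%:R != 0 :> R[i]. Proof. by rewrite pnatr_eq0 -lt0n. Qed.

Let Lxy := is_basis_sl2 det (is_basis_w L).

Lemma area_neighbour : cross (w1 L') (w2 L') = cross (w1 L) (w2 L) / m%:R.
Proof. by rewrite /L' /= cross_divn cross_int det mul1r. Qed.

Lemma neighbour_sub z : z \in in_lattice L -> z \in in_lattice L'.
Proof.
move=> /(proj2 Lxy)[a [b ->]]; apply/in_latticeP; exists (a * m%:Z), b.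
by rewrite rmorphM /= -pmulrn; field.
Qed.

Lemma neighbour_mul z : z \in in_lattice L' -> m%:R * z \in in_lattice L.
Proof.
move=> /in_latticeP[a [b ->]]; apply/(proj2 Lxy); exists a, (m%:Z * b).
by rewrite rmorphM /= -pmulrn; field.
Qed.

Lemma neighbour_not_scaled k : no_complex_mult L -> (1 < m)%N ->
  ~ (forall z, z \in in_lattice L <-> k * z \in in_lattice L').
Proof.
move=> ncm m1 kP; have area := scale_area kP.
have [q qE] : exists q : int, m%:R * k = q%:~R.
  by apply: ncm => z zL; rewrite -mulrA; apply: neighbour_mul; apply/kP.
have kE : k = q%:~R / m%:R by rewrite -qE mulrC mulKf.
have k0 := scale_neq0 kP.
(* Writing x / m as k z with z in L gives x = q z, and x is primitive, so q = 1 or -1. Then m^2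
   |k|^2 = 1, while the areas give |k|^2 = 1 / m, forcing m = 1. *)
have : w1 L' / k \in in_lattice L.
  apply/kP; rewrite mulrC divfK //; apply/in_latticeP; exists 1, 0; ring.
move=> /in_latticeP[a [b e]].
have /(cross_free (proj1 (is_basis_w L)))[ua vb] :
    u%:~R * w1 L + v%:~R * w2 L =
    (q * a)%:~R * w1 L + (q * b)%:~R * w2 L.
  transitivity (q%:~R * (w1 L' / k)); last by rewrite e !rmorphM /=; ring.
  have q0 : q%:~R != 0 :> R[i] by rewrite -qE mulf_neq0.
  by rewrite kE /=; field; rewrite q0 mC.
have q1 : q ^+ 2 = 1.
  have : q * (a * s - b * r) = 1 by rewrite -det ua vb; ring.
  move/(congr1 absz); rewrite abszM => /eqP; rewrite muln_eq1 => /andP[/eqP q1 _].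
  by have [->|->] : q = 1 \/ q = -1 by lia.
have := normsq_mul_nat qE; rewrite q1.
move: area; rewrite area_neighbour.
rewrite mulrC => /(mulfI (lt0r_neq0 (cross_lattice_gt0 L))) ->.
rewrite expr2 mulfK ?pnatr_eq0 -?lt0n // => /eqP.
by rewrite (eqr_nat R m 1) => /eqP m1'; rewrite m1' in m1.
Qed.

End Neighbour.

Lemma neighbours_scaled_eq {L} {m : nat} {u v r s u' v' r' s' : int} (m0 : (0 < m)%N)
    (det : u * s - v * r = 1) (det' : u' * s' - v' * r' = 1) k :
  no_complex_mult L ->
  (forall z, z \in in_lattice (neighbour L m0 det) <->
     k * z \in in_lattice (neighbour L m0 det')) ->
  (m%:Z %| u * v' - u' * v)%Z.
Proof.
move=> ncm kP; have area := scale_area kP.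
have mC : m%:R != 0 :> R[i] by rewrite pnatr_eq0 -lt0n.
have [q qE] : exists q : int, m%:R * k = q%:~R.
  apply: ncm => z zL; rewrite -mulrA.
  apply: (neighbour_mul _ m0 det'); apply/kP.
  exact: neighbour_sub.
have := normsq_mul_nat qE.
move: area; rewrite !area_neighbour.
have /lt0r_neq0 A0 : 0 < cross (w1 L) (w2 L) / m%:R.
  by rewrite divr_gt0 ?cross_lattice_gt0 // ltr0n.
rewrite -[RHS]mul1r => /(mulIf A0) ->; rewrite mulr1.
rewrite -[m%:R in LHS]/((m%:Z)%:~R) -rmorphXn => /intr_inj /= /esym/eqP.
rewrite eqf_sqr => qm.
(* Equal areas leave only k = 1 and k = -1, so the first lattice lies in the second. *)
have kin z : z \in in_lattice (neighbour L m0 det) ->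
    z \in in_lattice (neighbour L m0 det').
  move/kP; case/orP: qm qE => /eqP-> qE.
    have -> : k = 1 by apply: (mulfI mC); rewrite qE mulr1.
    by rewrite mul1r.
  have -> : k = -1 by apply: (mulfI mC); rewrite qE mulrN1 rmorphN.
  by rewrite mulN1r rpredN.
have : w1 (neighbour L m0 det) \in
    in_lattice (neighbour L m0 det').
  by apply: kin; apply/in_latticeP; exists 1, 0; ring.
move=> /in_latticeP[a [b]] /= e.
(* Modulo m, (u, v) is a times (u', v'), so their determinant vanishes. *)
have /(cross_free (proj1 (is_basis_w L)))[-> ->] :
    u%:~R * w1 L + v%:~R * w2 L =
    (a * u' + b * m%:Z * r')%:~R * w1 L + (a * v' + b * m%:Z * s')%:~R * w2 L.
  apply: (mulIf (invr_neq0 mC)); rewrite {}e !rmorphD !rmorphM /= -!pmulrn.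
  by field.
apply/dvdzP; exists (b * (r' * v' - u' * s')); ring.
Qed.

End Generic.

Theorem theorem3p3 (R : realType) (N : nat) (hN : (0 < N)%N) (G : level_kind)
    (alpha : enhanced R N G -> R[i]) (halpha : modular_invariant alpha)
    (hmodel : good_model alpha)
    (m : nat) (hm1 : (1 < m)%N) (hmN : coprime m N)
    (hG : (m%:Z = 1 %[mod N%:Z])%Z \/ (m%:Z = -1 %[mod N%:Z])%Z \/ G = Gamma0)
    (Phi : {poly {poly int}}) (hPhi : is_modular_polynomial alpha m Phi) :
  swapXY Phi = Phi.
Proof.
have [monPhi sizePhi zeros] := hPhi.
have scaled e e' : alpha e = alpha e' -> exists k, forall z,
    z \in in_lattice (curve e) <-> k * z \in in_lattice (curve e').
  by move=> /(Defs.inv_inj halpha); exact: enhanced_iso_scale.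
have [I [u [v [r [s [cardI det inj]]]]]] := unimodular_family m hm1.
have m0 := ltnW hm1.
have [n nm] : exists n : int, (N%:Z %| n * m%:Z - 1)%Z.
  have [a [b e]] := Bezoutz m N; exists a.
  apply/dvdzP; exists (- b); rewrite mulNr -[1]/(1%N%:Z) -(eqP hmN).
  by rewrite -[(gcdn m N)%:Z]/(gcdz m N) -e; ring.
pose L := @generic_lattice R; pose E j := standard_enhanced hN G (L j).
pose E' j i := neighbour_enhanced hN G (L j) m0 (det i) nm.
apply: (@swapXY_of_zeros R Phi _ I (fun j => alpha (E j))
  (fun j i => alpha (E' j i)) monPhi sizePhi cardI) => [i j e|j i i' e|j i|j i|j i].
(* Equal values give homotheties in both directions, hence both inequalities. *)
- apply/eqP; rewrite eqn_leq; apply/andP; split.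
    by have [k] := scaled _ _ e; exact: generic_scale_le.
  by have [k] := scaled _ _ (esym e); exact: generic_scale_le.
- have [k] := scaled _ _ e.
  by move/(neighbours_scaled_eq m0 (det i) (det i') _ (generic_no_complex_mult j)); exact: inj.
- apply/eqP => e; have [k] := scaled _ _ (esym e).
  exact: (neighbour_not_scaled _ m0 (det i) k (generic_no_complex_mult j) hm1).
- by apply/zeros; exact: to_neighbour.
- by apply/zeros; exact: from_neighbour.
Qed.
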